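(* Let $C$ and $L$ be the conditionality and likelihood relations on the set $\mathcal{I}$ of inference bases, and let $\bar{C}$ be the equivalence relation generated by $C$. Then $C\subset\bar{C}=L$, where the first containment is proper.
   Context: A relation on a set $D$ is a subset $R\subset D\times D$; $\bar{R}$ denotes the equivalence relation generated by $R$, i.e. the smallest equivalence relation on $D$ containing $R$. $\mathcal{I}$ is the set of all inference bases $I=(E,x)$, where $E=(\mathcal{X}_E,\{f_{E,\theta}:\theta\in\Theta_E\})$ is a model, $\mathcal{X}_E$ is a sample space, $\{f_{E,\theta}:\theta\in\Theta_E\}$ is a collection of probability density functions on $\mathcal{X}_E$ with respect to some support measure $\mu_E$ on $\mathcal{X}_E$, and $x\in\mathcal{X}_E$ is the observed data. Measure-theoretic considerations are ignored, and in general the discussion can be considered restricted to the case where $\mathcal{X}_E$ and $\Theta_E$ are finite, with $\mu_E$ counting measure. Write $I_i=(E_i,x_i)$. Likelihood relation $L$: $(I_1,I_2)\in L$ whenever $\Theta_{E_1}=\Theta_{E_2}$ and there exists $c>0$ such that $f_{E_1,\theta}(x_1)=c f_{E_2,\theta}(x_2)$ for every $\theta$. A statistic $a$ (a function on $\mathcal{X}_E$) is ancillary for $E$ if its distribution under $f_{E,\theta}$ is the same for all $\theta\in\Theta_E$. The conditional model given $a(x_0)$ is the model, with parameter set $\Theta_E$, consisting of the conditional distributions of the data under each $f_{E,\theta}$ given that $a$ takes the value $a(x_0)$. Conditionality relation $C$: $(I_1,I_2)\in C$ whenever $\Theta_{E_1}=\Theta_{E_2}$, $x_1=x_2$ and there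 exists an ancillary statistic $a$ for $E_1$ such that the conditional model given $a(x_1)$ is given by $E_2$, or with the roles of $I_1$ and $I_2$ reversed.
   Formalization: In C, ''x1 = x2'' and ''the conditional model is given by E2'' are read up to a bijective relabelling of sample points matching the data; with literal equality the closure of C forces x1 = x2, while L relates a uniform model on {0,1} observed at 0 and at 1. Sample spaces are finite. *)

(* Defs.v *)
From Stdlib Require Import Relation_Definitions.
From mathcomp Require Import all_boot all_order all_algebra.
From mathcomp Require Import all_classical all_reals.
Set Implicit Arguments.
Unset Strict Implicit.
Unset Printing Implicit Defensive.
Import Order.TTheory GRing.Theory Num.Theory.
Local Open Scope classical_set_scope.
Local Open Scope ring_scope.

(* The smallest equivalence relation containing A.  Relations are Stdlib's
   curried ones, because inference bases quantify over finite types and so live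
   in a universe too large for mathcomp's set. *)
Definition generated_equivalence (D : Type) (A : relation D) : relation D :=
  fun x y => forall B : relation D, equivalence D B -> inclusion D A B -> B x y.

Definition proper_inclusion (D : Type) (A B : relation D) : Prop :=
  inclusion D A B /\ ~ inclusion D B A.

(* Sample spaces are finite with counting measure as support measure.
   Parameter sets are arbitrary subsets of a universe T, so that the condition
   that two models have the same parameter set is an equality of sets; the
   values of density outside the parameter set are never used. *)
Record model (R : realType) (T : Type) := Model {
  sample : finType;
  param : set T;
  density : T -> sample -> R;
  density_ge0 : forall t x, param t -> 0 <= density t x;
  density_sum1 : forall t, param t -> \sum_x density t x = 1 }.

Record inference_base (R : realType) (T : Type) := InferenceBase {
  model_of :> model R T;
  data : sample model_of }.

Definition likelihood_relation (R : realType) (T : Type) :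
    relation (inference_base R T) :=
  fun I1 I2 => param I1 = param I2 /\
    exists2 c : R, 0 < c &
      forall t, param I1 t -> density t (data I1) = c * density t (data I2).

Section Conditioning.
Variables (R : realType) (T : Type) (E : model R T).
Variables (V : eqType) (a : sample E -> V).

Definition statistic_distr (t : T) (v : V) : R :=
  \sum_(x : sample E | a x == v) density t x.

Definition ancillary : Prop :=
  forall t t', param E t -> param E t' ->
  forall v, statistic_distr t v = statistic_distr t' v.

Variable x0 : sample E.

Definition cond_sample : finType := {x : sample E | a x == a x0}.

(* If the event a = a x0 has probability zero this is identically 0, hence not
   the density of any model: such events are never conditioned upon. *)
Definition cond_density (t : T) (y : cond_sample) : R :=
  density t (val y) / statistic_distr t (a x0).

End Conditioning.

(* Sample spaces are abstract types, so the conditional model is compared with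
   E2 up to a relabelling phi of sample points, and the equality of the
   observed data is equality through phi.  Without such an identification
   every pair in the generated equivalence would carry the same data label
   (e.g. (1, x) in a mixture could never be identified with x in its first
   component), whereas the likelihood relation ignores labels. *)
Definition conditional_of (R : realType) (T : Type)
    (I1 I2 : inference_base R T) : Prop :=
  param I1 = param I2 /\
  exists (V : eqType) (a : sample I1 -> V), ancillary a /\
  exists phi : sample I2 -> cond_sample a (data I1),
    [/\ bijective phi,
        data I1 = val (phi (data I2))
      & forall t, param I2 t -> forall y,
          density t y = cond_density t (phi y)].

Definition conditionality_relation (R : realType) (T : Type) :
    relation (inference_base R T) :=
  fun I1 I2 => conditional_of I1 I2 \/ conditional_of I2 I1.

(* Main.v *)
Require Import Defs.
From Stdlib Require Import Relation_Definitions.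
From mathcomp Require Import all_boot all_order all_algebra.
From mathcomp Require Import all_classical all_reals.
From mathcomp Require Import lra.

(** Conditioning on an ancillary divides every density of the model by the
    probability of the observed event, and ancillarity says that this divisor
    does not depend on the parameter.  So [C] is contained in the equivalence
    relation [L], and hence so is the generated equivalence.

    The converse needs only two steps of [C].  Suppose that
    [f1 t x1 = c * f2 t x2] for all [t].  Toss a coin, with probability
    [p = 1 / (1 + c)] of performing the first experiment and [q = c / (1 + c)]
    of performing the second.  The mixture has sample space [X1 + X2], and its
    points [inl x1] and [inr x2] have the same probability
    [p * f1 t x1 = q * f2 t x2] for every [t].  Exchanging these two points
    turns the block [inr X2] into a block [B] that still has probability [q]
    and looks like the second experiment, but that now contains [inl x1] in the
    place of [inr x2].  Membership in [inl X1] and membership in [B] are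
    therefore both ancillary; given the single outcome [inl x1], conditioning
    on the former yields the first inference base (up to relabelling), and
    conditioning on the latter yields the second.

    The generated equivalence is larger than [C] because a conditional model on
    as many points as the original one must come from a constant ancillary, and
    so leaves the density of the data unchanged, whereas [L] only asks for
    proportionality. *)

Set Implicit Arguments.
Unset Strict Implicit.
Unset Printing Implicit Defensive.
Import Order.TTheory GRing.Theory Num.Theory.
Local Open Scope classical_set_scope.
Local Open Scope ring_scope.

Section Inference.
Variables (R : realType) (T : Type).
Implicit Types I J : inference_base R T.

Lemma likelihood_equivalence :
  equivalence (inference_base R T) (@likelihood_relation R T).
Proof.
split.
- by move=> I; split=> //; exists 1 => // t _; rewrite mul1r.
- move=> I J K [IJ [c c0 cE]] [JK [d d0 dE]]; split; first by rewrite IJ.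
  exists (c * d); first exact: mulr_gt0.
  by move=> t It; rewrite cE // dE -?IJ // mulrA.
- move=> I J [IJ [c c0 cE]]; split=> //.
  exists c^-1; first by rewrite invr_gt0.
  by move=> t Jt; rewrite cE ?IJ // mulKf // gt_eqF.
Qed.

Lemma generated_equivalence_equivalence (D : Type) (A : relation D) :
  equivalence D (generated_equivalence A).
Proof.
split.
- by move=> x B [].
- move=> x y z xy yz B eqB AB; have [_ trB _] := eqB.
  exact: trB (xy B eqB AB) (yz B eqB AB).
- move=> x y xy B eqB AB; have [_ _ symB] := eqB.
  exact: symB (xy B eqB AB).
Qed.

Lemma generated_equivalence_sub (D : Type) (A : relation D) :
  inclusion D A (generated_equivalence A).
Proof. by move=> x y Axy B _; apply. Qed.

(** The constant of proportionality is the probability of the event that is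
    conditioned on; were it zero, the conditional densities would vanish
    identically instead of summing to one. *)
Lemma conditional_likelihood I J :
  conditional_of I J -> likelihood_relation I J.
Proof.
move=> [IJ [V [a [anc [phi [_ dataE densE]]]]]]; split=> //.
have [[s Is]|noparam] := pselect (exists s, param I s); last first.
  by exists 1 => // t It; case: noparam; exists t.
set P := fun t => statistic_distr a t (a (data I)).
have PE t : param I t -> P t = P s by move=> It; exact: anc.
have P_ge0 : 0 <= P s by apply: sumr_ge0 => x _; exact: density_ge0.
have P_neq0 : P s != 0.
  apply/eqP => P0; have Js : param J s by rewrite -IJ.
  have := density_sum1 Js; rewrite big1 => [/esym/eqP|y _].
    by rewrite oner_eq0.
  by rewrite densE // /cond_density -/(P s) P0 invr0 mulr0.
exists (P s); first by rewrite lt_def P_neq0.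
move=> t It; rewrite densE -?IJ // /cond_density -dataE -/(P t) PE //.
by rewrite mulrC divfK.
Qed.

Lemma conditionality_sub_likelihood :
  inclusion _ (@conditionality_relation R T) (@likelihood_relation R T).
Proof.
have [_ _ symL] := likelihood_equivalence.
by move=> I J [/conditional_likelihood|/conditional_likelihood/symL].
Qed.

(** A part of the sample space on which the densities are those of another
    model times a constant [p] has probability [p] whatever the parameter, so
    its indicator is ancillary, and conditioning on it gives the other model. *)
Lemma conditional_of_embedding I J (g : sample J -> sample I) (p : R) :
    param I = param J -> p != 0 -> injective g -> g (data J) = data I ->
    (forall t, param J t -> forall y, density t (g y) = p * density t y) ->
  conditional_of I J.
Proof.
move=> IJ p0 g_inj g_data gE; split=> //.
pose a (x : sample I) := x \in codom g.
have distr_true t : param J t -> statistic_distr a t true = p.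
  move=> Jt; rewrite /statistic_distr.
  rewrite (eq_bigl (mem (codom g))) => [|x]; last by rewrite eqb_id.
  rewrite -big_uniq /=; last by rewrite map_inj_uniq // enum_uniq.
  rewrite big_image /= (eq_bigr _ (fun y _ => gE t Jt y)) -mulr_sumr.
  by rewrite density_sum1 // mulr1.
have distr_false t : param J t -> statistic_distr a t false = 1 - p.
  move=> Jt; have It : param I t by rewrite IJ.
  rewrite -(density_sum1 It) (bigID (fun x => a x == true)) /=.
  rewrite -/(statistic_distr a t true) distr_true // [p + _]addrC addrK.
  by apply: eq_bigl => x; rewrite eqbF_neg eqb_id.
have a_data : a (data I) = true by rewrite /a -g_data codom_f.
exists bool, a; split.
  by move=> t t'; rewrite IJ => Jt Jt' [|]; rewrite ?distr_true ?distr_false.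
have a_g y : a (g y) == a (data I) by rewrite a_data /a codom_f.
exists (fun y => exist _ (g y) (a_g y)); split.
- apply: inj_card_bij => [y z [] /g_inj //|].
  rewrite card_sig -(card_codom g_inj).
  by apply/subset_leq_card/fintype.subsetP => x; rewrite inE a_data eqb_id.
- by rewrite /= g_data.
- move=> t Jt y; rewrite /cond_density /= a_data distr_true // gE //.
  by rewrite mulrC mulKf.
Qed.

Section Mixture.
Variables (E F : model R T) (p q : R).
Hypotheses (EF : param E = param F) (p_ge0 : 0 <= p) (q_ge0 : 0 <= q).
Hypothesis pq1 : p + q = 1.

Definition mixture_density (t : T) (z : sample E + sample F) : R :=
  match z with
  | inl x => p * density t x
  | inr y => q * density t y
  end.

Lemma mixture_density_ge0 t z : param E t -> 0 <= mixture_density t z.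
Proof.
by move=> Et; case: z => x /=; rewrite mulr_ge0 // density_ge0 // -EF.
Qed.

Lemma mixture_density_sum1 t : param E t -> \sum_z mixture_density t z = 1.
Proof.
move=> Et; rewrite big_sumType /= -!mulr_sumr !density_sum1 -?EF //.
by rewrite !mulr1.
Qed.

Definition mixture : model R T :=
  Model mixture_density_ge0 mixture_density_sum1.

End Mixture.

(** Both inference bases are conditional versions of the mixture whose weights
    make [inl (data I)] and [inr (data J)] equally likely. *)
Lemma likelihood_common_mixture I J : likelihood_relation I J ->
  exists2 K, conditional_of K I & conditional_of K J.
Proof.
move=> [IJ [c c_gt0 cE]].
pose p := (1 + c)^-1; pose q := c * p.
have c1_gt0 : 0 < 1 + c by rewrite addr_gt0.
have p_gt0 : 0 < p by rewrite invr_gt0.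
have q_gt0 : 0 < q by rewrite mulr_gt0.
have pq1 : p + q = 1 by rewrite -[X in X + _]mul1r -mulrDl divff ?gt_eqF.
pose M := mixture IJ (ltW p_gt0) (ltW q_gt0) pq1.
pose K := @InferenceBase R T M (inl (data I)).
exists K.
  apply: (@conditional_of_embedding K I inl p) => //; first by rewrite gt_eqF.
  by move=> x y [].
(* The block of [J], with the equally likely point [inl (data I)] in the place
   of [inr (data J)]. *)
pose g (y : sample J) : sample M :=
  if y == data J then inl (data I) else inr y.
apply: (@conditional_of_embedding K J g q) => //=.
- by rewrite gt_eqF.
- move=> y z; rewrite /g; case: eqVneq => [->|_]; case: eqVneq => [->|_] //.
  by case.
- by rewrite /g eqxx.
- move=> t Jt y; rewrite /g; case: eqVneq => [->|//] /=.
  by rewrite cE ?IJ // mulrA [p * c]mulrC.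
Qed.

Lemma likelihood_sub_generated :
  inclusion _ (@likelihood_relation R T)
    (generated_equivalence (@conditionality_relation R T)).
Proof.
move=> I J /likelihood_common_mixture [K KI KJ].
have [_ trC _] := generated_equivalence_equivalence
  (@conditionality_relation R T).
by apply: (trC _ K); apply: generated_equivalence_sub; [right|left].
Qed.

(** When no sample point is lost, the conditioning event is the whole sample
    space, of probability one. *)
Lemma conditional_of_same_card I J t :
    conditional_of I J -> #|sample I| = #|sample J| -> param I t ->
  density t (data I) = density t (data J).
Proof.
move=> [IJ [V [a [_ [phi [phi_bij dataE densE]]]]]] cardIJ It.
have a_const x : a x == a (data I).
  have cardE : #|[pred x | a x == a (data I)]| = #|sample I|.
    by rewrite cardIJ (bij_eq_card phi_bij) card_sig.
  by have /(_ x) := subset_cardP cardE (subset_predT _); rewrite !inE.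
rewrite densE -?IJ // /cond_density -dataE /statistic_distr.
by rewrite (eq_bigl _ _ a_const) density_sum1 // divr1.
Qed.

Lemma conditionality_same_card I J t :
    conditionality_relation I J -> #|sample I| = #|sample J| -> param I t ->
  density t (data I) = density t (data J).
Proof.
move=> [IJ|JI] cardIJ It; first exact: conditional_of_same_card.
by apply/esym/conditional_of_same_card => //; have [-> _] := JI.
Qed.

Section Bernoulli.
Variable r : R.
Hypothesis r01 : 0 <= r <= 1.

Let bernoulli_density (_ : T) (b : bool) : R := if b then r else 1 - r.

Let bernoulli_ge0 t b : [set: T] t -> 0 <= bernoulli_density t b.
Proof. by move=> _; case/andP: r01 => r0 r1; case: b; rewrite //= subr_ge0. Qed.

Let bernoulli_sum1 t : [set: T] t -> \sum_b bernoulli_density t b = 1.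
Proof. by move=> _; rewrite big_bool /= addrC subrK. Qed.

Definition bernoulli_success : inference_base R T :=
  @InferenceBase R T (Model bernoulli_ge0 bernoulli_sum1) true.

End Bernoulli.

(** Successes of probabilities [1] and [1/2], neither depending on the
    parameter, have proportional likelihoods; but both experiments have two
    outcomes, so that conditionality would force these probabilities to agree. *)
Lemma likelihood_not_sub_conditionality (t0 : T) :
  ~ inclusion _ (@likelihood_relation R T) (@conditionality_relation R T).
Proof.
move=> LC.
have one01 : 0 <= (1 : R) <= 1 by lra.
have half01 : 0 <= (2^-1 : R) <= 1 by lra.
have /LC CIJ :
    likelihood_relation (bernoulli_success one01) (bernoulli_success half01).
  by split=> //; exists 2 => [|t _ /=]; lra.
have /= := conditionality_same_card CIJ erefl (I : [set: T] t0).
by lra.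
Qed.

End Inference.

Theorem theorem6 (R : realType) (T : Type) (t0 : T) :
  let C := @conditionality_relation R T in
  let L := @likelihood_relation R T in
  proper_inclusion C (generated_equivalence C) /\
  same_relation (inference_base R T) (generated_equivalence C) L.
Proof.
move=> C L; split; split.
- exact: generated_equivalence_sub.
- move=> genC; apply: (@likelihood_not_sub_conditionality R T t0) => I J LIJ.
  exact: genC (likelihood_sub_generated LIJ).
- move=> I J genIJ.
  exact: (genIJ L (@likelihood_equivalence R T)
    (@conditionality_sub_likelihood R T)).
- exact: likelihood_sub_generated.
Qed.
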